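(* If $x$ is any complex number not equal to a positive integer, then $$\sum_{n=1}^\infty\frac{1}{n(n-x)}\sum_{m=1}^{n-1}\frac{1}{m-x}=\sum_{n=1}^\infty\frac{1}{n^2(n-x)}.$$
   Context: The inner sum is empty (equal to $0$) when $n=1$. *)

(* Defs.v *)
From Stdlib Require Import Reals.
From Coquelicot Require Import Coquelicot.

(* [is_series] indexes its terms from 0, hence the shift: the sum runs over
   n >= 1, and the value [a 0] is irrelevant. *)
Definition is_sum_from_1 (a : nat -> C) (l : C) : Prop :=
  @is_series C_AbsRing C_NormedModule (fun k : nat => a (S k)) l.

(* Main.v *)
Require Import Defs.
From Stdlib Require Import Reals Lra Lia.
From Coquelicot Require Import Coquelicot.

(** Write [a k = 1 / (k - x)] and let [H] be the harmonic numbers.  For [k < n],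
    [a n * a k = (a k - a n) / (n - k)].  Substituting this in the left-hand
    partial sum up to [N] and collecting the coefficient of [a k] gives
    [(H_(N-k) - H_N + H_k - H_(k-1)) / k], that is, [1 / k^2] minus
    [(H_N - H_(N-k)) / k].  The second part is an error term: as
    [a k = O(1/k)] and [H_N - H_(N-k) <= k / (N+1-k)], its contribution is
    [O(sum_k 1 / (k (N+1-k))) = O(H_N / (N+1))], which tends to [0]. *)

(** * Harmonic numbers: growth and differences *)

Definition harmonic (n : nat) : R := sum_n_m (fun j : nat => / INR j) 1 n.

Lemma harmonic_S (n : nat) : harmonic (S n) = harmonic n + / INR (S n).
Proof.
  unfold harmonic. rewrite sum_n_Sm; [reflexivity | lia].
Qed.

Lemma harmonic_0 : harmonic 0 = 0.
Proof. unfold harmonic. apply (@sum_n_m_zero R_AbelianMonoid). lia. Qed.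

(** A crude bound in place of the logarithm: only [harmonic n = o(n)] is needed, and this form goes
    through by induction on square-root increments. *)
Lemma harmonic_le_sqrt (n : nat) : harmonic n <= 2 * sqrt (INR n).
Proof.
  induction n as [|n IH].
  - rewrite harmonic_0. simpl INR. rewrite sqrt_0. lra.
  - rewrite harmonic_S.
    assert (Hn := pos_INR n).
    rewrite S_INR in *.
    set (s := sqrt (INR n)) in *. set (t := sqrt (INR n + 1)).
    assert (Hs : s * s = INR n) by (apply sqrt_sqrt; lra).
    assert (Ht : t * t = INR n + 1) by (apply sqrt_sqrt; lra).
    assert (0 <= s) by apply sqrt_pos.
    assert (0 < t) by (apply sqrt_lt_R0; lra).
    assert (s <= t) by (apply sqrt_le_1; lra).
    assert (E : / (INR n + 1) <= 2 * (t - s)); [|lra].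
    apply Rmult_le_reg_l with (INR n + 1); [lra|].
    rewrite Rinv_r by lra.
    rewrite <- Ht.
    (* [1 = (t - s) * (t + s) <= 2 * t * (t - s)] and [1 <= t]. *)
    assert (1 <= t) by nra.
    assert (1 <= 2 * t * (t - s)) by nra.
    nra.
Qed.

(** The difference consists of [k] reciprocals [1/j] with [n - k < j <= n], each nonnegative and at
    most [1/(n+1-k)]. *)
Lemma harmonic_diff_le (n k : nat) :
  (k <= n)%nat -> 0 <= harmonic n - harmonic (n - k) <= INR k / INR (S n - k).
Proof.
  induction k as [|k IH]; intros Hk.
  - replace (n - 0)%nat with n by lia. unfold Rdiv. simpl (INR 0). lra.
  - assert (H := IH ltac:(lia)).
    assert (E : harmonic (n - k) = harmonic (n - S k) + / INR (n - k)).
    { replace (n - k)%nat with (S (n - S k)) by lia. apply harmonic_S. }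
    replace (S n - S k)%nat with (n - k)%nat by lia.
    replace (S n - k)%nat with (S (n - k)) in H by lia.
    rewrite S_INR in *.
    assert (P : 0 < INR (n - k)) by (apply lt_0_INR; lia).
    assert (Q : 0 < / INR (n - k)) by (apply Rinv_0_lt_compat; lra).
    assert (B : INR k / (INR (n - k) + 1) <= INR k / INR (n - k)).
    { apply Rmult_le_compat_l; [apply pos_INR|]. apply Rinv_le_contravar; lra. }
    unfold Rdiv in *. lra.
Qed.

(** * Finite sums: reversal, comparison and a convolution of reciprocals *)

Lemma sum_n_m_rev {G : AbelianMonoid} (f : nat -> G) (n : nat) :
  sum_n_m (fun k => f (S n - k)%nat) 1 n = sum_n_m f 1 n.
Proof.
  induction n as [|n IH].
  - rewrite !sum_n_m_zero by lia. reflexivity.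
  - rewrite sum_Sn_m by lia.
    rewrite <- (sum_n_m_S (fun k => f (S (S n) - k)%nat)).
    rewrite sum_n_Sm by lia.
    rewrite <- IH, plus_comm. reflexivity.
Qed.

Lemma sum_n_m_le_loc (u v : nat -> R) (n m : nat) :
  (forall k, (n <= k <= m)%nat -> u k <= v k) -> sum_n_m u n m <= sum_n_m v n m.
Proof.
  induction m as [|m IH]; intros H.
  - destruct n as [|n].
    + rewrite !sum_n_n. apply H. lia.
    + rewrite !sum_n_m_zero by lia. apply Rle_refl.
  - destruct (Nat.le_gt_cases n (S m)) as [Hn|Hn].
    + rewrite !sum_n_Sm by lia.
      apply Rplus_le_compat; [apply IH; intros; apply H; lia | apply H; lia].
    + rewrite !sum_n_m_zero by lia. apply Rle_refl.
Qed.

(** Partial fractions: [1/(k(n+1-k)) = (1/k + 1/(n+1-k))/(n+1)], and by reversal both halves sum to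
    [harmonic n]. *)
Lemma sum_inv_mult_rev (n : nat) :
  sum_n_m (fun k => / (INR k * INR (S n - k))) 1 n = 2 * harmonic n / INR (S n).
Proof.
  transitivity (sum_n_m (fun k => mult (/ INR (S n))
                                   (plus (/ INR k) (/ INR (S n - k)))) 1 n).
  - apply sum_n_m_ext_loc. intros k Hk.
    change (/ (INR k * INR (S n - k)) = / INR (S n) * (/ INR k + / INR (S n - k))).
    rewrite minus_INR by lia.
    assert (INR k < INR (S n)) by (apply lt_INR; lia).
    assert (0 < INR k) by (apply lt_0_INR; lia).
    field. lra.
  - rewrite sum_n_m_mult_l, sum_n_m_plus, (sum_n_m_rev (fun k => / INR k)).
    fold (harmonic n). change (/ INR (S n) * (harmonic n + harmonic n)
      = 2 * harmonic n / INR (S n)).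
    unfold Rdiv. ring.
Qed.

(** * The error term and the exact identity for partial sums *)

Definition remainder (a : nat -> C) (N : nat) : C :=
  sum_n_m (fun k => (RtoC (harmonic N - harmonic (N - k)) * (a k / RtoC (INR k)))%C) 1 N.

Lemma INR_neq_0_C (n : nat) : (1 <= n)%nat -> RtoC (INR n) <> RtoC 0.
Proof.
  intros Hn E. apply RtoC_inj in E. apply (not_0_INR n); [lia | exact E].
Qed.

(* [ring] and [field] look up their structure from the type of the equation and
   fail when it is a Coquelicot carrier merely convertible to [C]. *)
Ltac eq_in_C := match goal with |- ?u = ?v => change (@eq C u v) end.

Lemma Copp_mult_distr_l (u v : C) : (- (u * v) = - u * v)%C.
Proof. ring. Qed.

Lemma Cmult_sum_n_m (c : C) (u : nat -> C) (n m : nat) :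
  (c * sum_n_m u n m = sum_n_m (fun k => c * u k) n m)%C.
Proof. symmetry. apply (@sum_n_m_mult_l C_Ring). Qed.

Lemma Cplus_sum_n_m (u v : nat -> C) (n m : nat) :
  (sum_n_m u n m + sum_n_m v n m = sum_n_m (fun k => u k + v k) n m)%C.
Proof. symmetry. apply (@sum_n_m_plus C_AbelianMonoid). Qed.

(** Passing from [N] to [N+1] changes the coefficient of [a k / k] by
    [1/(N+1) - 1/(N+1-k) = -k/((N+1)(N+1-k))], whose factor [k] cancels. The last summand is the new
    index [k = N+1], where [harmonic 0 = 0]. *)
Lemma remainder_S (a : nat -> C) (N : nat) :
  remainder a (S N) =
  (remainder a N - / RtoC (INR (S N)) * sum_n_m (fun k => a k / RtoC (INR (S N - k))) 1 N
   + RtoC (harmonic (S N)) * (a (S N) / RtoC (INR (S N))))%C.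
Proof.
  unfold remainder at 1. rewrite sum_n_Sm by lia.
  rewrite Nat.sub_diag, harmonic_0, Rminus_0_r.
  change (@plus C_AbelianMonoid) with Cplus.
  f_equal.
  unfold Cminus. rewrite Copp_mult_distr_l.
  unfold remainder. rewrite Cmult_sum_n_m, Cplus_sum_n_m.
  apply sum_n_m_ext_loc. intros k Hk.
  replace (S N - k)%nat with (S (N - k)) by lia.
  rewrite !harmonic_S.
  replace (S (N - k)) with (S N - k)%nat by lia.
  rewrite minus_INR by lia.
  assert (INR k < INR (S N)) by (apply lt_INR; lia).
  assert (D : (RtoC (INR (S N)) - RtoC (INR k))%C <> RtoC 0).
  { rewrite <- RtoC_minus. intros E. apply RtoC_inj in E. lra. }
  assert (Hk0 := INR_neq_0_C k ltac:(lia)).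
  assert (HN0 := INR_neq_0_C (S N) ltac:(lia)).
  rewrite !RtoC_minus, !RtoC_plus, !RtoC_inv, !RtoC_minus
    by (try apply not_0_INR; try lia; lra).
  eq_in_C.
  field. repeat split; assumption.
Qed.

(** Induction on [N]. By [Ha], the new inner sum times [a (S N)] splits into the sum of
    [a k / (N+1-k)], which matches the one in [remainder_S], and [- a (S N) * harmonic N]. Since
    [harmonic (S N) - harmonic N = 1/(N+1)], what is left is [a (S N) / (N+1)^2]. *)
Lemma partial_sums_eq (a : nat -> C)
  (Ha : forall n k, (1 <= k < n)%nat ->
     (a n * a k = (a k - a n) / RtoC (INR (n - k)))%C) (N : nat) :
  sum_n_m (fun n => (a n / RtoC (INR n) * sum_n_m a 1 (n - 1))%C) 1 N =
  (sum_n_m (fun n => a n / RtoC (INR n) ^ 2)%C 1 N - remainder a N)%C.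
Proof.
  induction N as [|N IH].
  - unfold remainder. rewrite !sum_n_m_zero by lia.
    change (@zero C_AbelianMonoid) with (RtoC 0). eq_in_C. ring.
  - rewrite !(sum_n_Sm _ 1 N) by lia. rewrite IH, remainder_S.
    replace (S N - 1)%nat with N by lia.
    change (@plus C_AbelianMonoid) with Cplus.
    assert (E : (a (S N) * sum_n_m a 1 N =
      sum_n_m (fun k => a k / RtoC (INR (S N - k))) 1 N
      - a (S N) * RtoC (harmonic N))%C).
    { assert (EH : RtoC (harmonic N) = sum_n_m (fun k => / RtoC (INR (S N - k)))%C 1 N).
      { rewrite (sum_n_m_rev (fun k => / RtoC (INR k))%C). unfold harmonic.
        clear. induction N as [|N IH].
        - rewrite !sum_n_m_zero by lia. reflexivity.
        - rewrite !sum_n_Sm by lia. rewrite <- IH.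
          rewrite <- RtoC_inv by (apply not_0_INR; lia).
          apply RtoC_plus. }
      rewrite EH. unfold Cminus. rewrite Copp_mult_distr_l.
      rewrite !Cmult_sum_n_m, Cplus_sum_n_m.
      apply sum_n_m_ext_loc. intros k Hk.
      rewrite (Ha (S N) k) by lia. unfold Cdiv. eq_in_C. ring. }
    assert (HN0 := INR_neq_0_C (S N) ltac:(lia)).
    replace (a (S N) / RtoC (INR (S N)) * sum_n_m a 1 N)%C
      with (/ RtoC (INR (S N)) * (a (S N) * sum_n_m a 1 N))%C
      by (unfold Cdiv; ring).
    rewrite E, harmonic_S, RtoC_plus, RtoC_inv by (apply not_0_INR; lia).
    eq_in_C. field. exact HN0.
Qed.

(** * Vanishing of the error term *)

Lemma remainder_bound (a : nat -> C) (M : R)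
  (HM : forall k, (1 <= k)%nat -> Cmod (a k) <= M / INR k) (N : nat) :
  Cmod (remainder a N) <= M * (2 * harmonic N / INR (S N)).
Proof.
  rewrite <- sum_inv_mult_rev.
  eapply Rle_trans; [apply (@norm_sum_n_m C_AbsRing C_NormedModule)|].
  eapply Rle_trans; [|right; apply (@sum_n_m_mult_l R_Ring)].
  apply sum_n_m_le_loc. intros k Hk.
  change (Cmod (RtoC (harmonic N - harmonic (N - k)) * (a k / RtoC (INR k)))
    <= M * / (INR k * INR (S N - k))).
  destruct (harmonic_diff_le N k ltac:(lia)) as [H0 H1].
  assert (P : 0 < INR k) by (apply lt_0_INR; lia).
  assert (Q : 0 < INR (S N - k)) by (apply lt_0_INR; lia).
  rewrite Cmod_mult, Cmod_div by (apply INR_neq_0_C; lia).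
  rewrite !Cmod_R, !Rabs_pos_eq by lra.
  (* Factor the target into the bound for the harmonic difference times the bound for [a k / k]. *)
  replace (M * / (INR k * INR (S N - k)))
    with (INR k / INR (S N - k) * (M / INR k / INR k)) by (field; lra).
  apply Rmult_le_compat; [exact H0 | | exact H1 | ].
  - apply Rmult_le_pos; [apply Cmod_ge_0 | left; apply Rinv_0_lt_compat; lra].
  - apply Rmult_le_compat_r; [left; apply Rinv_0_lt_compat; lra | apply HM; lia].
Qed.

Lemma is_lim_seq_harmonic_div : is_lim_seq (fun n => harmonic n / INR (S n)) 0.
Proof.
  apply is_lim_seq_le_le with (u := fun _ => 0) (w := fun n => 2 * / sqrt (INR (S n))).
  - intros n.
    assert (P : 0 < INR (S n)) by (apply lt_0_INR; lia).
    assert (S0 : 0 < sqrt (INR (S n))) by (apply sqrt_lt_R0; lra).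
    assert (SS := sqrt_sqrt (INR (S n)) (Rlt_le _ _ P)).
    (* The case [k = n] gives nonnegativity of [harmonic n]. *)
    destruct (harmonic_diff_le n n (le_n n)) as [H0 _].
    rewrite Nat.sub_diag, harmonic_0 in H0.
    split.
    + apply Rmult_le_pos; [lra | left; apply Rinv_0_lt_compat; lra].
    + apply Rmult_le_reg_r with (INR (S n)); [lra|].
      unfold Rdiv. rewrite Rmult_assoc, Rinv_l, Rmult_1_r by lra.
      rewrite <- SS at 2.
      replace (2 * / sqrt (INR (S n)) * (sqrt (INR (S n)) * sqrt (INR (S n))))
        with (2 * sqrt (INR (S n))) by (field; lra).
      eapply Rle_trans; [apply harmonic_le_sqrt|].
      apply Rmult_le_compat_l; [lra|].
      apply sqrt_le_1; [apply pos_INR | lra | apply le_INR; lia].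
  - apply is_lim_seq_const.
  - replace (Finite 0) with (Rbar_mult 2 (Rbar_inv p_infty))
      by (simpl; f_equal; ring).
    apply is_lim_seq_scal_l. apply is_lim_seq_inv; [|discriminate].
    apply (filterlim_comp _ _ _ (fun n => INR (S n)) sqrt eventually (Rbar_locally p_infty)).
    + apply (is_lim_seq_incr_1 INR). apply is_lim_seq_INR.
    + apply filterlim_sqrt_p.
Qed.

(** * Size of [1 / (k - x)] *)

Lemma INR_minus_neq_0 (x : C)
  (hx : forall k : nat, (1 <= k)%nat -> x <> RtoC (INR k)) (k : nat) :
  (1 <= k)%nat -> (RtoC (INR k) - x)%C <> RtoC 0.
Proof.
  intros Hk E. apply (hx k Hk). symmetry.
  replace x with (x + RtoC 0)%C by ring. rewrite <- E. ring.
Qed.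

(** Once [k > 2|x|], the triangle inequality gives [|k - x| >= k/2], so the constant 2 works; the
    finitely many smaller [k] are absorbed by a maximum. *)
Lemma Cmod_inv_INR_minus_bound (x : C)
  (hx : forall k : nat, (1 <= k)%nat -> x <> RtoC (INR k)) :
  exists M : R, forall k, (1 <= k)%nat -> Cmod (/ (RtoC (INR k) - x)) <= M / INR k.
Proof.
  assert (D := INR_minus_neq_0 x hx).
  (* Carrying [2 <= M] lets the same constant serve the tail. *)
  assert (F : forall K : nat, exists M, 2 <= M /\ forall k, (1 <= k <= K)%nat ->
     Cmod (/ (RtoC (INR k) - x)) <= M / INR k).
  { induction K as [|K [M [HM IH]]].
    - exists 2. split; [lra|]. intros; lia.
    - exists (Rmax M (Cmod (/ (RtoC (INR (S K)) - x)) * INR (S K))).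
      split; [eapply Rle_trans; [exact HM | apply Rmax_l]|].
      intros k Hk.
      assert (P : 0 < INR k) by (apply lt_0_INR; lia).
      assert (Q : 0 < / INR k) by (apply Rinv_0_lt_compat; lra).
      destruct (Nat.eq_dec k (S K)) as [->|Hne].
      + apply Rmult_le_reg_r with (INR (S K)); [lra|].
        unfold Rdiv. rewrite Rmult_assoc, Rinv_l, Rmult_1_r by lra.
        apply Rmax_r.
      + eapply Rle_trans; [apply IH; lia|].
        apply Rmult_le_compat_r; [lra | apply Rmax_l]. }
  destruct (INR_unbounded (2 * Cmod x)) as [K HK].
  destruct (F K) as [M [HM HF]].
  exists M. intros k Hk.
  destruct (Nat.le_gt_cases k K) as [HkK|HkK]; [apply HF; lia|].
  assert (P : 0 < INR k) by (apply lt_0_INR; lia).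
  assert (HkK' : INR K < INR k) by (apply lt_INR; lia).
  assert (L : INR k / 2 <= Cmod (RtoC (INR k) - x)).
  { assert (T := Cmod_triangle (RtoC (INR k) - x) x).
    replace (RtoC (INR k) - x + x)%C with (RtoC (INR k)) in T by ring.
    rewrite Cmod_R, Rabs_pos_eq in T by lra. lra. }
  rewrite Cmod_inv by (apply D; lia).
  apply Rle_trans with (/ (INR k / 2)); [apply Rinv_le_contravar; lra|].
  replace (/ (INR k / 2)) with (2 / INR k) by (field; lra).
  apply Rmult_le_compat_r; [left; apply Rinv_0_lt_compat|]; lra.
Qed.

(** * Convergence of the right-hand series by comparison *)

Lemma ex_series_inv_mult_S : ex_series (fun k => / (INR (S k) * INR (S (S k)))).
Proof.
  exists 1. change (is_lim_seq (sum_n (fun k => / (INR (S k) * INR (S (S k))))) 1).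
  (* Telescoping of [1/((k+1)(k+2)) = 1/(k+1) - 1/(k+2)]. *)
  apply is_lim_seq_ext with (fun n => 1 - / INR (S (S n))).
  - intros n. induction n as [|n IH].
    + rewrite sum_O. simpl. field.
    + rewrite sum_Sn, <- IH. change (@plus R_AbelianMonoid) with Rplus.
      assert (Hn := pos_INR n). rewrite !S_INR. field. lra.
  - replace (Finite 1) with (Finite (1 - 0)) by (f_equal; ring).
    apply is_lim_seq_minus'; [apply is_lim_seq_const|].
    apply (is_lim_seq_inv (fun n => INR (S (S n))) p_infty); [|discriminate].
    apply (is_lim_seq_incr_1 (fun n => INR (S n))).
    apply (is_lim_seq_incr_1 INR). apply is_lim_seq_INR.
Qed.

Lemma ex_series_div_sqr (a : nat -> C) (M : R)
  (HM : forall k, (1 <= k)%nat -> Cmod (a k) <= M / INR k) :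
  @ex_series C_AbsRing C_NormedModule (fun k => a (S k) / RtoC (INR (S k)) ^ 2)%C.
Proof.
  apply (@ex_series_le C_AbsRing C_CompleteNormedModule _
    (fun k => (2 * M) * / (INR (S k) * INR (S (S k))))).
  - intros k. change (Cmod (a (S k) / RtoC (INR (S k)) ^ 2)
      <= (2 * M) * / (INR (S k) * INR (S (S k)))).
    assert (H1 : 1 <= INR (S k)) by (rewrite S_INR; assert (Hn := pos_INR k); lra).
    assert (B := HM (S k) ltac:(lia)).
    (* The sign of [M] is forced by its bounding a modulus. *)
    assert (M0 : 0 <= M).
    { assert (C0 := Rle_trans _ _ _ (Cmod_ge_0 _) B).
      replace M with (M / INR (S k) * INR (S k)) by (field; lra).
      apply Rmult_le_pos; lra. }
    rewrite Cmod_div by (apply Cpow_nz, INR_neq_0_C; lia).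
    rewrite Cmod_pow, Cmod_R, Rabs_pos_eq by lra.
    rewrite (S_INR (S k)). set (t := INR (S k)) in *.
    apply Rle_trans with (M / t / t ^ 2).
    + apply Rmult_le_compat_r; [|exact B].
      left. apply Rinv_0_lt_compat. nra.
    (* The factor 2 pays for the comparison: [(t+1)/2 <= t <= t^2] for [t >= 1]. *)
    + replace (M / t / t ^ 2) with (M * / (t * (t * t))) by (field; lra).
      replace (2 * M * / (t * (t + 1))) with (M * / (t * ((t + 1) / 2))) by (field; lra).
      apply Rmult_le_compat_l; [exact M0|].
      apply Rinv_le_contravar; nra.
  - apply (@ex_series_scal R_AbsRing R_NormedModule (2 * M)), ex_series_inv_mult_S.
Qed.

(** * Passage to the limit in the partial sums *)

Theorem theorem1 (x : C)
  (hx : forall k : nat, (1 <= k)%nat -> x <> RtoC (INR k)) :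
  exists l : C,
    is_sum_from_1
      (fun n : nat =>
         (RtoC 1 / (RtoC (INR n) * (RtoC (INR n) - x))
          * sum_n_m (fun m : nat => RtoC 1 / (RtoC (INR m) - x)) 1%nat (n - 1)%nat)%C) l
    /\ is_sum_from_1
      (fun n : nat =>
         (RtoC 1 / (RtoC (INR n) ^ 2 * (RtoC (INR n) - x)))%C) l.
Proof.
  assert (D := INR_minus_neq_0 x hx).
  destruct (Cmod_inv_INR_minus_bound x hx) as [M HM].
  set (a := fun k : nat => (/ (RtoC (INR k) - x))%C).
  assert (Ha : forall n k, (1 <= k < n)%nat ->
     (a n * a k = (a k - a n) / RtoC (INR (n - k)))%C).
  { intros n k Hk. unfold a.
    assert (Hn0 := D n ltac:(lia)). assert (Hk0 := D k ltac:(lia)).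
    assert (Hnk := INR_neq_0_C (n - k) ltac:(lia)).
    rewrite minus_INR, RtoC_minus in * by lia.
    field. repeat split; assumption. }
  destruct (ex_series_div_sqr a M HM) as [l Hl].
  exists l. unfold is_sum_from_1. split.
  - apply is_series_ext with
      (fun k => a (S k) / RtoC (INR (S k)) * sum_n_m a 1 (S k - 1))%C.
    { intros k. assert (Hk := D (S k) ltac:(lia)).
      assert (H0 := INR_neq_0_C (S k) ltac:(lia)).
      f_equal.
      - unfold a. eq_in_C. field. split; assumption.
      - apply sum_n_m_ext. intros m. unfold a, Cdiv. eq_in_C. ring. }
    (* The [n]-th partial sum of a series indexed from 0 covers the terms 1 to [n+1], hence the
       remainder at [S n]. *)
    assert (R0 : filterlim (fun n => opp (remainder a (S n))) eventually
                   (@locally C_NormedModule zero)).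
    { apply (@filterlim_norm_zero _ C_AbsRing C_NormedModule); [apply eventually_filter|].
      change (is_lim_seq (fun n => @norm C_AbsRing C_NormedModule
        (opp (remainder a (S n)))) 0).
      apply (is_lim_seq_le_le (fun _ => 0) _
        (fun n => M * 2 * (harmonic (S n) / INR (S (S n))))).
      - intros n. rewrite (@norm_opp C_AbsRing C_NormedModule).
        split; [apply norm_ge_0|].
        eapply Rle_trans; [apply (remainder_bound a M HM)|].
        right. unfold Rdiv. ring.
      - apply is_lim_seq_const.
      - replace (Finite 0) with (Rbar_mult (M * 2) 0) by (simpl; f_equal; ring).
        apply is_lim_seq_scal_l.
        apply (is_lim_seq_incr_1 (fun n => harmonic n / INR (S n))).
        apply is_lim_seq_harmonic_div. }
    unfold is_series in *.
    (* Writing the limit as [l + 0] presents it as the sum of the limits of the right-hand partial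
       sums and of the negated remainder. *)
    rewrite <- (@plus_zero_r C_AbelianGroup l).
    eapply filterlim_ext; [|eapply filterlim_comp_2;
      [exact Hl | exact R0 | apply (@filterlim_plus C_AbsRing C_NormedModule)]].
    intros n. unfold sum_n.
    rewrite (sum_n_m_S (fun k => a k / RtoC (INR k) ^ 2)%C),
      (sum_n_m_S (fun k => a k / RtoC (INR k) * sum_n_m a 1 (k - 1))%C).
    symmetry. apply (partial_sums_eq a Ha).
  - apply is_series_ext with (2 := Hl).
    intros k. assert (Hk := D (S k) ltac:(lia)).
    assert (H0 := INR_neq_0_C (S k) ltac:(lia)).
    unfold a. eq_in_C. field. split; assumption.
Qed.
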